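(* Let $H$ be a separable complex Hilbert space, $A\in\mathcal{B}(H)^+$, $T\in\mathcal{B}(H)$, and let $m\ge0$, $n\geq 1$ be integers. Assume that $\mathcal{I}^m_A(T)\ge 0$. Then the following hold. (1) If $T$ is $(A;(m,n))$-isosymmetric, then for every $s\in\mathbb{R}$ the operator $e^{isT}$ is $(\mathcal{I}^m_A(T),n)$-isometric. In particular, if $T$ is $(A,n)$-symmetric, then $e^{isT}$ is $(A,n)$-isometric for every $s\in\mathbb{R}$. (2) If $T$ is skew $(A;(m,n))$-isosymmetric, then for every $s\in\mathbb{R}$ the operator $e^{isT}$ is left $(\mathcal{I}^m_A(T),n)$-invertible. In particular, if $T$ is skew $(A,n)$-symmetric, then for every $s\in\mathbb{R}$ the operator $e^{isT}$ is left $(A,n)$-invertible with left inverse $e^{isT^*}$.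
   Context: $\mathcal{B}(H)$ is the algebra of bounded linear operators on $H$ and $\mathcal{B}(H)^+$ the set of positive (semi-definite) operators. For $A,T\in\mathcal{B}(H)$ and nonnegative integers $m,n$ put $$\mathcal{I}^m_A(T)=\sum_{k=0}^m(-1)^{m-k}\binom mk T^{*k}AT^k,\qquad \Omega_A^{m,n}(T)=\sum_{k=0}^n(-1)^{n-k}\binom nk T^{*k}\mathcal{I}^m_A(T)T^{n-k},\qquad \Lambda_A^{m,n}(T)=\sum_{k=0}^n\binom nk T^{*k}\mathcal{I}^m_A(T)T^{n-k}.$$ $T$ is $(A;(m,n))$-isosymmetric if $\Omega_A^{m,n}(T)=0$, and skew $(A;(m,n))$-isosymmetric if $\Lambda_A^{m,n}(T)=0$. $T$ is $(A,n)$-symmetric if $\Omega_A^{0,n}(T)=0$ and skew $(A,n)$-symmetric if $\Lambda_A^{0,n}(T)=0$. For a positive operator $B$, $S\in\mathcal{B}(H)$ is $(B,n)$-isometric if $\mathcal{I}^n_B(S)=0$. For $B\in\mathcal{B}(H)^+$ and an integer $n\ge1$, $S$ is left $(B,n)$-invertible by $R\in\mathcal{B}(H)$ (with left inverse $R$; $R$ is called a left $(B,n)$-inverse of $S$) if $\sum_{k=0}^n(-1)^{n-k}\binom nk R^kBS^k=0$; $S$ is left $(B,n)$-invertible if such an $R$ exists. *)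

(* Defs.v *)
From HB Require Import structures.
From mathcomp Require Import all_boot all_order all_algebra sesquilinear.
From mathcomp Require Import all_classical all_reals all_analysis.
From mathcomp Require Import complex.

Set Implicit Arguments.
Unset Strict Implicit.
Unset Printing Implicit Defensive.

Import Order.TTheory GRing.Theory Num.Theory.
Import numFieldNormedType.Exports.

Local Open Scope classical_set_scope.
Local Open Scope complex_scope.
Local Open Scope ring_scope.

(* Complex Hilbert spaces: the inner product is linear in its first argument
   and conjugate-linear in the second. *)
HB.mixin Record CompleteNormedModule_isHilbert (R : realType) H
    & CompleteNormedModule R[i] H := {
  inner : {dot H for (@Num.conj R[i])};
  inner_norm : forall x : H, inner x x = `|x| ^+ 2
}.

#[short(type="hilbertType")]
HB.structure Definition Hilbert (R : realType) :=
  {H of CompleteNormedModule R[i] H & CompleteNormedModule_isHilbert R H}.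

Definition separable_space (T : topologicalType) : Prop :=
  exists2 D : set T, countable D & dense D.

Section RealComplex.
Context {R : realType}.

Lemma real_complexD (x y : R) : (x + y)%:C = x%:C + y%:C.
Proof. exact: rmorphD. Qed.

Lemma real_complexM (x y : R) : (x * y)%:C = x%:C * y%:C.
Proof. exact: rmorphM. Qed.

Lemma Re_normr (V : normedZmodType R[i]) (x : V) :
  (complex.Re `|x|)%:C = `|x|.
Proof. by rewrite RRe_real // normr_real. Qed.

End RealComplex.

Section BoundedOperators.
Context {R : realType} (H : normedModType R[i]).

(* Boolean, so that [bop] below is a subtype of the module [H -> H] and gets its
   sum and scaling from there. *)
Definition bounded_linear : pred (H -> H) := fun f =>
  `[< linear f /\ exists M : R, forall x, `|f x| <= M%:C * `|x| >].

Record bop := BOp { bop_fun :> H -> H; _ : bounded_linear bop_fun }.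

HB.instance Definition _ := [isSub for bop_fun].
HB.instance Definition _ := [Choice of bop by <:].

Lemma bounded_linear_submod : subsemimod_closed bounded_linear.
Proof.
split; [split|].
- apply/asboolP; split=> [a u v|]; first by rewrite scaler0 addr0.
  by exists 0 => x; rewrite normr0 mul0r.
- move=> f g /asboolP[lf [M fM]] /asboolP[lg [N gN]]; apply/asboolP; split.
    by move=> a u v /=; rewrite !fctE lf lg scalerDr addrACA.
  exists (M + N) => x; rewrite real_complexD mulrDl.
  by rewrite (le_trans (ler_normD _ _)) // lerD.
- move=> a f /asboolP[lf [M fM]]; apply/asboolP; split.
    move=> b u v; change (a *: f (b *: u + v) = b *: (a *: f u) + a *: f v).
    by rewrite lf scalerDr !scalerA mulrC.
  exists (complex.Re `|a| * M) => x; change (`|a *: f x| <= (complex.Re `|a| * M)%:C * `|x|).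
  rewrite normrZ real_complexM Re_normr -mulrA.
  by rewrite ler_wpM2l.
Qed.

HB.instance Definition _ :=
  GRing.SubChoice_isSubLmodule.Build R[i] (H -> H) bounded_linear bop
    bounded_linear_submod.

Lemma bop_linear (f : bop) : linear f.
Proof. by case: f => f /= /asboolP[]. Qed.

HB.instance Definition _ (f : bop) :=
  GRing.isLinear.Build R[i] H H *:%R f (bop_linear f).

Lemma bopP (f : bop) : exists M : R, forall x, `|f x| <= M%:C * `|x|.
Proof. by case: f => f /= /asboolP[]. Qed.

Lemma bop_eq (f g : bop) : f =1 g -> f = g.
Proof. by move=> fg; apply/val_inj/funext. Qed.

Lemma id_bounded_linear : bounded_linear idfun.
Proof. by apply/asboolP; split=> //; exists 1 => x; rewrite mul1r. Qed.

Lemma comp_bounded_linear (f g : bop) : bounded_linear (f \o g).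
Proof.
apply/asboolP; split=> [a u v|]; first by rewrite /= !linearP.
have [M fM] := bopP f; have [N gN] := bopP g.
exists (`|M| * N) => x; rewrite (le_trans (fM _)) //.
rewrite (@le_trans _ _ (`|M|%:C * `|g x|)) //.
  by rewrite ler_wpM2r // lecR ler_norm.
by rewrite real_complexM -mulrA ler_wpM2l // lecR.
Qed.

Definition bop_one : bop := BOp id_bounded_linear.
Definition bop_mul (f g : bop) : bop := BOp (comp_bounded_linear f g).

Lemma bop_mulA : associative bop_mul.
Proof. by move=> f g h; apply: bop_eq. Qed.

Lemma bop_mul1 : left_id bop_one bop_mul.
Proof. by move=> f; apply: bop_eq. Qed.

Lemma bop_mulr1 : right_id bop_one bop_mul.
Proof. by move=> f; apply: bop_eq. Qed.

Lemma bop_mulDl : left_distributive bop_mul +%R.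
Proof. by move=> f g h; apply: bop_eq. Qed.

Lemma bop_mulDr : right_distributive bop_mul +%R.
Proof. by move=> f g h; apply: bop_eq => x /=; rewrite linearD. Qed.

HB.instance Definition _ := GRing.Zmodule_isPzRing.Build bop
  bop_mulA bop_mul1 bop_mulr1 bop_mulDl bop_mulDr.

Definition opnorm (f : bop) : R :=
  sup [set complex.Re `|f x| | x in [set x : H | `|x| <= 1]].

Lemma has_sup_opnorm (f : bop) :
  has_sup [set complex.Re `|f x| | x in [set x : H | `|x| <= 1]].
Proof.
split; first by exists (complex.Re `|f 0|), 0 => //=; rewrite normr0.
have [M fM] := bopP f; exists `|M| => _ [x /= x1 <-].
rewrite -lecR Re_normr (le_trans (fM x)) //.
rewrite (@le_trans _ _ (`|M|%:C * `|x|)) //.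
  by rewrite ler_wpM2r // lecR ler_norm.
by rewrite ler_piMr // lecR.
Qed.

Lemma opnormP (f : bop) x : `|f x| <= (opnorm f)%:C * `|x|.
Proof.
have [->|x0] := eqVneq x 0; first by rewrite linear0 !normr0 mulr0.
rewrite -ler_pdivrMr ?normr_gt0 //.
have -> : `|f x| / `|x| = `|f (`|x|^-1 *: x)|.
  by rewrite linearZ normrZ normfV normr_id mulrC.
rewrite -[`|f _|]Re_normr lecR.
apply: ub_le_sup; first exact: (has_sup_opnorm f).2.
exists (`|x|^-1 *: x) => //=.
by rewrite normrZ normfV normr_id mulVf // normr_eq0.
Qed.

Lemma opnorm_le (f : bop) (M : R) : 0 <= M ->
  (forall x, `|f x| <= M%:C * `|x|) -> opnorm f <= M.
Proof.
move=> M0 fM; apply: ge_sup; first exact: (has_sup_opnorm f).1.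
move=> _ [x /= x1 <-]; rewrite -lecR Re_normr.
by rewrite (le_trans (fM x)) // ler_piMr // lecR.
Qed.

Lemma opnorm_ge0 (f : bop) : 0 <= opnorm f.
Proof.
apply: ub_le_sup; first exact: (has_sup_opnorm f).2.
by exists 0; rewrite /= ?normr0 // linear0 normr0.
Qed.

Lemma ler_opnormD (f g : bop) :
  (opnorm (f + g))%:C <= (opnorm f)%:C + (opnorm g)%:C.
Proof.
rewrite -real_complexD lecR; apply: opnorm_le => [|x].
  by rewrite addr_ge0 ?opnorm_ge0.
by rewrite real_complexD mulrDl (le_trans (ler_normD _ _)) // lerD ?opnormP.
Qed.

Lemma opnormZ_le a (f : bop) : (opnorm (a *: f))%:C <= `|a| * (opnorm f)%:C.
Proof.
rewrite -(Re_normr a) -real_complexM lecR.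
have a0 : 0 <= complex.Re `|a| by rewrite -lecR Re_normr normr_ge0.
apply: opnorm_le => [|x]; first by rewrite mulr_ge0 ?opnorm_ge0.
rewrite real_complexM Re_normr -mulrA.
by change (`|a *: f x| <= `|a| * ((opnorm f)%:C * `|x|));
   rewrite normrZ ler_wpM2l // opnormP.
Qed.

Lemma opnormZ a (f : bop) : (opnorm (a *: f))%:C = `|a| * (opnorm f)%:C.
Proof.
have [->|a0] := eqVneq a 0.
  apply/eqP; rewrite eq_le opnormZ_le normr0 mul0r lecR opnorm_ge0 //.
apply/eqP; rewrite eq_le opnormZ_le /= -ler_pdivlMl ?normr_gt0 // -normfV.
by rewrite -{1}[f](scalerK a0) opnormZ_le.
Qed.

Lemma opnorm0_eq0 (f : bop) : (opnorm f)%:C = 0 -> f = 0.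
Proof.
move=> f0; apply: bop_eq => x; apply/eqP; rewrite -normr_le0.
by rewrite (le_trans (opnormP f x)) // f0 mul0r.
Qed.

HB.instance Definition _ := Lmodule_isNormed.Build R[i] bop
  ler_opnormD opnormZ opnorm0_eq0.

(* The limit is taken in the operator norm, which is the norm of [bop H]. *)
Definition op_exp (X : bop) : bop :=
  limn (series (fun k => (k`!%:R : R[i])^-1 *: X ^+ k)).

End BoundedOperators.

Section OperatorClasses.
Context {R : realType} {H : hilbertType R}.
Implicit Types A B S T : bop H.

(* The unique bounded operator characterized below; it exists by the Riesz
   representation theorem. *)
Definition adj T : bop H :=
  xget 0 [set S : bop H | forall x y : H, inner (T x) y = inner x (S y)].

(* The order of [R[i]] makes [0 <= z] imply that [z] is real. *)
Definition positive_op A : Prop := forall x : H, 0 <= inner (A x) x.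

Definition iso_op (m : nat) A T : bop H :=
  \sum_(k < m.+1) (-1) ^+ (m - k) *+ 'C(m, k) * (adj T ^+ k * A * T ^+ k).

Definition Omega (m n : nat) A T : bop H :=
  \sum_(k < n.+1)
    (-1) ^+ (n - k) *+ 'C(n, k) * (adj T ^+ k * iso_op m A T * T ^+ (n - k)).

Definition Lambda (m n : nat) A T : bop H :=
  \sum_(k < n.+1) (adj T ^+ k * iso_op m A T * T ^+ (n - k)) *+ 'C(n, k).

Definition isosymmetric A m n T : Prop := Omega m n A T = 0.
Definition skew_isosymmetric A m n T : Prop := Lambda m n A T = 0.
Definition nsymmetric A n T : Prop := Omega 0 n A T = 0.
Definition skew_nsymmetric A n T : Prop := Lambda 0 n A T = 0.

Definition nisometric B n S : Prop := iso_op n B S = 0.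

Definition left_ninverse B n S Q : Prop :=
  \sum_(k < n.+1) (-1) ^+ (n - k) *+ 'C(n, k) * (Q ^+ k * B * S ^+ k) = 0.

Definition left_ninvertible B n S : Prop := exists Q, left_ninverse B n S Q.

End OperatorClasses.

(* Main.v *)
Require Import Defs.
From mathcomp Require Import all_boot all_order all_algebra sesquilinear.
From mathcomp Require Import all_classical all_reals all_analysis.
From mathcomp Require Import complex ring lra.

Set Implicit Arguments.
Unset Strict Implicit.
Unset Printing Implicit Defensive.

Import Order.TTheory GRing.Theory Num.Theory.
Import numFieldNormedType.Exports.

Local Open Scope complex_scope.
Local Open Scope ring_scope.

(** Fix an operator [B], and let [P], [Q] be bounded operators.  On the space
    of bounded operators put [D Z = P Z + Z Q] and [S Z = e^P Z e^Q].  Left and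
    right multiplications commute, so [D^n B] is the binomial sum of the
    [P^k B Q^(n-k)] and [(S - 1)^n B] is the alternating binomial sum of the
    [(e^P)^k B (e^Q)^k].  Formally [S = e^D], so [S - 1] is a multiple of [D]
    and [D^n B = 0] forces [(S - 1)^n B = 0].

    The fixed points of [S] make this precise.  If [D Z = 0] then [P]
    and [- Q] are intertwined by [Z], hence so are their exponentials:
    [e^P Z = Z e^(-Q)], that is, [S Z = Z].  Since [S] commutes with [D],
    [D^n B = 0] gives [D^(n-1) (S B - B) = (S - 1) (D^(n-1) B) = 0], and an
    induction on [n] concludes ([op_exp_sandwich_nilpotent]).

    Take [Q = i s T].  With [P = i s (adj T)] the sum [D^n B] is a multiple of
    Lambda, which gives the skew statements, [e^(i s (adj T))] being the
    left inverse.  With [P = - i s (adj T)] it is a multiple of Omega, and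
    [e^P] is the adjoint of [e^(i s T)], which gives the isometric statements.

    Two analytic facts carry this argument.  Bounded operators on a complete
    space are complete for the operator norm, so the exponential series
    converges; that [e^(-Q)] is inverse to [e^Q] follows from
    [e^(P + Q) = e^P e^Q] for commuting [P] and [Q], where the error in the
    Cauchy product is dominated by the same error for the real exponential
    ([op_expD]).  Adjoints exist by the Riesz theorem, proved by minimising
    [|x|^2 - 2 Re (f x)] ([riesz_representation]). *)

(** * Real-valued norms and sequential limits *)

Section RealNorm.
Context {R : realType} {V : normedModType R[i]}.
Implicit Types (x y : V) (u v : nat -> V).

(** The norm of a complex space has values in [R[i]], which is only
    partially ordered; estimates against real series need a norm in [R]. *)
Definition rnorm x : R := complex.Re `|x|.

Lemma rnormE x : (rnorm x)%:C = `|x|.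
Proof. exact: Re_normr. Qed.

Lemma rnorm_ge0 x : 0 <= rnorm x.
Proof. by rewrite -lecR rnormE normr_ge0. Qed.

Lemma rnorm_le x (M : R) : (rnorm x <= M) = (`|x| <= M%:C).
Proof. by rewrite -rnormE lecR. Qed.

Lemma rnorm0 : rnorm (0 : V) = 0.
Proof. by rewrite /rnorm normr0. Qed.

Lemma rnormN x : rnorm (- x) = rnorm x.
Proof. by rewrite /rnorm normrN. Qed.

Lemma rnormD x y : rnorm (x + y) <= rnorm x + rnorm y.
Proof. by rewrite rnorm_le real_complexD !rnormE ler_normD. Qed.

Lemma rnormZ (a : R[i]) x : rnorm (a *: x) = complex.Re `|a| * rnorm x.
Proof.
by apply: complexI; rewrite real_complexM !rnormE Re_normr normrZ.
Qed.

Lemma rnorm_sum I (r : seq I) (P : pred I) (F : I -> V) :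
  rnorm (\sum_(i <- r | P i) F i) <= \sum_(i <- r | P i) rnorm (F i).
Proof.
elim/big_rec2: _ => [|i y x _ xy]; first by rewrite rnorm0.
by rewrite (le_trans (rnormD _ _)) // lerD.
Qed.

Lemma rnorm_dist x y : `|rnorm x - rnorm y| <= rnorm (x - y).
Proof.
rewrite ler_norml lerNl opprB !lerBlDr; apply/andP; split.
  by rewrite -(rnormN (x - y)) opprB (le_trans _ (rnormD _ _)) // subrK.
by rewrite (le_trans _ (rnormD _ _)) // subrK.
Qed.

Local Open Scope classical_set_scope.

Lemma cvg_rnormP u x : u @ \oo --> x <-> rnorm (u n - x) @[n --> \oo] --> (0 : R).
Proof.
split=> [/cvgrPdist_le ux|ux].
- apply/cvgrPdist_le => e e0.
  have e0' : 0 < e%:C :> R[i] by rewrite ltcR.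
  have := ux _ e0'; apply: filterS => n.
  by rewrite sub0r normrN ger0_norm ?rnorm_ge0 // distrC rnorm_le.
- apply/cvgrPdist_le => e e0.
  have eE : (complex.Re e)%:C = e by rewrite RRe_real // gtr0_real.
  have e0' : 0 < complex.Re e by rewrite -ltcR eE.
  move/cvgrPdist_le : ux => /(_ _ e0'); apply: filterS => n.
  by rewrite sub0r normrN ger0_norm ?rnorm_ge0 // rnorm_le eE distrC.
Qed.

Lemma cvg_rnorm_le u x (d : nat -> R) :
  (forall n, rnorm (u n - x) <= d n) -> d @ \oo --> (0 : R) -> u @ \oo --> x.
Proof.
move=> ud d0; apply/cvg_rnormP; apply: (squeeze_cvgr _ (cvg_cst 0) d0).
by apply: nearW => n; rewrite rnorm_ge0 ud.
Qed.

Lemma cvg_rnorm u x : u @ \oo --> x -> rnorm (u n) @[n --> \oo] --> rnorm x.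
Proof.
move=> /cvg_rnormP ux; apply/cvgrPdist_le => e e0.
move/cvgrPdist_le : ux => /(_ _ e0); apply: filterS => n.
rewrite sub0r normrN ger0_norm ?rnorm_ge0 // distrC.
exact/le_trans/rnorm_dist.
Qed.

Lemma cvgn_unique u x y : u @ \oo --> x -> u @ \oo --> y -> x = y.
Proof. by move=> ux uy; apply: (cvg_unique (@norm_hausdorff _ _) ux uy). Qed.

Lemma rnorm_lim_le u x (M : R) :
  u @ \oo --> x -> (\forall n \near \oo, rnorm (u n) <= M) -> rnorm x <= M.
Proof.
move=> /cvg_rnorm ux uM; rewrite -(cvg_lim _ ux) //.
by apply: limr_le => //; apply/cvg_ex; eexists; exact: ux.
Qed.

End RealNorm.

Section Completeness.
Context {R : realType} {V : completeNormedModType R[i]}.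
Local Open Scope classical_set_scope.

Lemma rnorm_cauchy_cvg (u : nat -> V) :
  (forall e : R, 0 < e -> exists N, forall p q, (N <= p)%N -> (N <= q)%N ->
     rnorm (u p - u q) <= e) -> cvgn u.
Proof.
move=> u_cauchy; apply: cauchy_cvg; apply: cauchy_exP => e e0.
have eE : (complex.Re e)%:C = e by rewrite RRe_real // gtr0_real.
have e0' : 0 < complex.Re e by rewrite -ltcR eE.
have [N uN] := u_cauchy _ (divr_gt0 e0' (ltr0Sn _ 1)).
exists (u N), N => // n /= Nn.
rewrite -ball_normE /= -eE -rnormE ltcR (le_lt_trans (uN N n _ Nn)) //.
by rewrite ltr_pdivrMr // ltr_pMr // ltr1n.
Qed.

End Completeness.

(** * The Banach algebra of bounded operators *)

Section OperatorNorm.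
Context {R : realType} {H : normedModType R[i]}.
Implicit Types (a : R[i]) (f g X Y Z : bop H) (x : H).
Local Open Scope classical_set_scope.

Lemma rnorm_app f x : rnorm (f x) <= rnorm f * rnorm x.
Proof. by rewrite rnorm_le real_complexM !rnormE; exact: opnormP. Qed.

Lemma rnorm_bop_le f (M : R) :
  0 <= M -> (forall x, rnorm (f x) <= M * rnorm x) -> rnorm f <= M.
Proof.
move=> M0 fM; apply: opnorm_le => // x.
by rewrite -!rnormE -real_complexM lecR fM.
Qed.

Lemma rnorm_bopM f g : rnorm (f * g) <= rnorm f * rnorm g.
Proof.
apply: rnorm_bop_le => [|x]; first by rewrite mulr_ge0 ?rnorm_ge0.
rewrite -mulrA (le_trans (rnorm_app f (g x))) //.
by rewrite ler_wpM2l ?rnorm_ge0 ?rnorm_app.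
Qed.

Lemma rnorm_bop1 : rnorm (1 : bop H) <= 1.
Proof. by apply: rnorm_bop_le => // x; rewrite mul1r. Qed.

Lemma rnorm_bopX f n : rnorm (f ^+ n) <= rnorm f ^+ n.
Proof.
elim: n => [|n IHn]; first by rewrite !expr0 rnorm_bop1.
rewrite !exprS (le_trans (rnorm_bopM _ _)) //.
by rewrite ler_wpM2l ?rnorm_ge0.
Qed.

Lemma bopZl a f g : a *: f * g = a *: (f * g).
Proof. exact: bop_eq. Qed.

Lemma bopZr a f g : f * (a *: g) = a *: (f * g).
Proof.
by apply: bop_eq => x; change (f (a *: g x) = a *: f (g x)); rewrite linearZ.
Qed.

Lemma bopZX a f n : (a *: f) ^+ n = a ^+ n *: f ^+ n.
Proof.
elim: n => [|n IHn]; first by rewrite !expr0 scale1r.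
by rewrite !exprS IHn bopZl bopZr scalerA.
Qed.

Lemma bop_sumE (I : Type) (r : seq I) (P : pred I) (F : I -> bop H) x :
  (\sum_(i <- r | P i) F i) x = \sum_(i <- r | P i) F i x.
Proof. by elim/big_rec2: _ => // i y f _ <-. Qed.

Lemma cvg_app (u : nat -> bop H) f x :
  u @ \oo --> f -> u n x @[n --> \oo] --> f x.
Proof.
move=> /cvg_rnormP uf; apply: (@cvg_rnorm_le _ _ _ _
  (fun n => rnorm (u n - f) * rnorm x)).
  by move=> n; exact: (rnorm_app (u n - f)).
by rewrite -[0](mul0r (rnorm x)); exact: cvgMl.
Qed.

(** Joint continuity of the product: [u v - f g = (u - f) v + f (v - g)], and
    [v] is bounded because it converges. *)
Lemma cvg_bopM (u v : nat -> bop H) f g :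
  u @ \oo --> f -> v @ \oo --> g -> u n * v n @[n --> \oo] --> f * g.
Proof.
move=> /cvg_rnormP uf vg.
have vn := cvg_rnorm vg; move/cvg_rnormP : vg => vg.
apply: (@cvg_rnorm_le _ _ _ _ (fun n =>
  rnorm (u n - f) * rnorm (v n) + rnorm f * rnorm (v n - g))).
  move=> n; have -> : u n * v n - f * g = (u n - f) * v n + f * (v n - g).
    by rewrite mulrBl mulrBr addrA subrK.
  by rewrite (le_trans (rnormD _ _)) // lerD // rnorm_bopM.
rewrite -[0](addr0 0) -[X in X + _](mul0r (rnorm g)) -[X in _ + X](mulr0 (rnorm f)).
by apply: cvgD; [exact: cvgM | exact: cvgMr].
Qed.

End OperatorNorm.

Section OperatorCompleteness.
Context {R : realType} {H : completeNormedModType R[i]}.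
Local Open Scope classical_set_scope.

(** A norm-Cauchy sequence converges pointwise.  The pointwise limit inherits
    linearity, and letting [q] tend to infinity in [|u p x - u q x| <= e |x|]
    makes the convergence uniform on the unit ball, which also bounds the limit. *)
Lemma bop_cauchy_cvg (u : nat -> bop H) :
  (forall e : R, 0 < e -> exists N, forall p q, (N <= p)%N -> (N <= q)%N ->
     rnorm (u p - u q) <= e) -> cvgn u.
Proof.
move=> u_cauchy.
have u_app e : 0 < e -> exists N, forall p q, (N <= p)%N -> (N <= q)%N ->
    forall x, rnorm (u p x - u q x) <= e * rnorm x.
  move=> /u_cauchy[N uN]; exists N => p q Np Nq x.
  rewrite (le_trans (rnorm_app (u p - u q) x)) //.
  by rewrite ler_wpM2r ?rnorm_ge0 ?uN.
have ux x : cvgn (fun n => u n x).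
  apply: rnorm_cauchy_cvg => e e0.
  have d0 : 0 < rnorm x + 1 by rewrite ltr_wpDl ?rnorm_ge0.
  have [N uN] := u_app _ (divr_gt0 e0 d0); exists N => p q Np Nq.
  rewrite (le_trans (uN p q Np Nq x)) // mulrAC ler_pdivrMr //.
  by rewrite ler_pM2l // lerDl.
pose g x := limn (fun n => u n x).
have gE x : (fun n => u n x) @ \oo --> g x by exact: ux.
have g_dist e : 0 < e -> exists N, forall p, (N <= p)%N ->
    forall x, rnorm (u p x - g x) <= e * rnorm x.
  move=> /u_app[N uN]; exists N => p Np x.
  apply: (@rnorm_lim_le _ _ (fun n => u p x - u n x)).
    by apply: cvgB => //; exact: cvg_cst.
  by exists N => // q /= Nq; exact: uN.
have g_bounded : bounded_linear g.
  apply/asboolP; split=> [a x y|].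
    apply: (cvgn_unique (gE _)).
    have -> : (fun n => u n (a *: x + y)) = (fun n => a *: u n x + u n y).
      by apply/funext => n; rewrite linearP.
    by apply: cvgD => //; apply: cvgZr; exact: gE.
  have [N gN] := g_dist 1 ltr01.
  exists (1 + rnorm (u N)) => x; rewrite -[`|x|]rnormE -real_complexM -rnorm_le.
  have -> : g x = - (u N x - g x) + u N x by rewrite opprB subrK.
  by rewrite mulrDl (le_trans (rnormD _ _)) // rnormN lerD ?rnorm_app ?gN.
apply/cvg_ex; exists (BOp g_bounded); apply/cvg_rnormP/cvgrPdist_le => e e0.
have [N gN] := g_dist e e0; exists N => // n /= Nn.
rewrite sub0r normrN ger0_norm ?rnorm_ge0 //.
by apply: rnorm_bop_le; [exact: ltW | exact: gN].
Qed.

End OperatorCompleteness.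

(** * Cauchy products and the operator exponential *)

Section CauchyProduct.
Variable A : pzRingType.
Implicit Types (f : nat -> nat -> A) (a b : nat -> A).

(** Both sides sum [f i j] over the triangle [i + j < N], once along its
    antidiagonals and once along its rows. *)
Lemma sum_antidiagonal f N :
  \sum_(0 <= k < N) \sum_(0 <= i < k.+1) f i (k - i)%N =
  \sum_(0 <= i < N) \sum_(0 <= j < N - i) f i j.
Proof.
elim: N => [|N IHN]; first by rewrite !big_nil.
rewrite big_nat_recr //= IHN [in RHS]big_nat_recr //= subSnn big_nat1.
rewrite [X in _ + X]big_nat_recr //= subnn addrA -big_split /=; congr (_ + _).
by apply: eq_big_nat => i /andP[_ iN]; rewrite subSn ?(ltnW iN) // big_nat_recr.
Qed.

(** The product of two partial sums covers a square of indices, the partial sum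
    of the Cauchy product only a triangle.  The identity holds in any ring and
    has only products of one [a] and one [b] on the right, so that the operator
    error can be compared termwise with the real one. *)
Lemma cauchy_product_corner a b N :
  (\sum_(0 <= i < N) a i) * (\sum_(0 <= j < N) b j) -
    \sum_(0 <= k < N) \sum_(0 <= i < k.+1) a i * b (k - i)%N =
  \sum_(0 <= i < N) \sum_(N - i <= j < N) a i * b j.
Proof.
rewrite (sum_antidiagonal (fun i j => a i * b j)) mulr_suml -sumrB.
apply: eq_bigr => i _; rewrite mulr_sumr.
by rewrite (big_cat_nat (n := N - i)) ?leq_subr //= addrAC subrr add0r.
Qed.

End CauchyProduct.

Lemma inv_fact_binomial (F : numFieldType) k i : (i <= k)%N ->
  (k`!%:R)^-1 *+ 'C(k, i) = (i`!%:R)^-1 * ((k - i)`!%:R)^-1 :> F.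
Proof.
move=> ik; have f0 n : n`!%:R != 0 :> F by rewrite pnatr_eq0 -lt0n fact_gt0.
apply: (mulIf (f0 k)); rewrite mulrnAl mulVf //.
rewrite -(bin_fact ik) !natrM -invfM.
by rewrite mulrCA mulVf ?mulr1 // mulf_neq0.
Qed.

Lemma exp_coeffD (R : realType) (x y : R) k :
  exp_coeff (x + y) k = \sum_(0 <= i < k.+1) exp_coeff x i * exp_coeff y (k - i)%N.
Proof.
rewrite /exp_coeff /= addrC exprDn mulr_suml big_mkord; apply: eq_bigr => i _.
have ik : (i <= k)%N by rewrite -ltnS.
rewrite mulrnAl -mulrnAr (inv_fact_binomial _ ik).
by rewrite [_^-1 * _]mulrC [LHS]mulrACA mulrC.
Qed.

Section Exponential.
Context {R : realType} {H : completeNormedModType R[i]}.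
Implicit Types (X Y Z P Q : bop H).
Local Open Scope classical_set_scope.

(** The Weierstrass M-test in the operator norm. *)
Lemma cvg_bop_series (u : nat -> bop H) (a : nat -> R) :
  (forall k, rnorm (u k) <= a k) -> cvgn (series a) -> cvgn (series u).
Proof.
move=> ua /cvg_ex[l /cvgrPdist_le al]; apply: bop_cauchy_cvg => e e0.
have [N _ aN] := al _ (divr_gt0 e0 (ltr0Sn _ 1)); exists N.
have le_tail p q : (N <= p)%N -> (p <= q)%N ->
    rnorm (series u q - series u p) <= e.
  move=> Np pq; rewrite sub_series_geq // (le_trans (rnorm_sum _ _ _)) //.
  apply: (@le_trans _ _ (\sum_(p <= k < q) a k)); first exact: ler_sum.
  rewrite -sub_series_geq // (le_trans (ler_norm _)) //.
  rewrite -(subrK l (series a q)) -addrA (le_trans (ler_normD _ _)) //.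
  rewrite [e]splitr lerD ?aN // distrC aN //=; exact: leq_trans pq.
move=> p q Np Nq; have [pq|/ltnW qp] := leqP p q.
  by rewrite -rnormN opprB le_tail.
exact: le_tail.
Qed.

Definition exp_term X k : bop H := (k`!%:R)^-1 *: X ^+ k.

Lemma rnorm_exp_term X k : rnorm (exp_term X k) <= exp_coeff (rnorm X) k.
Proof.
rewrite rnormZ.
have -> : complex.Re `|(k`!%:R)^-1 : R[i]| = (k`!%:R)^-1 :> R.
  by apply: complexI; rewrite Re_normr normfV normr_nat fmorphV rmorph_nat.
by rewrite /exp_coeff /= [leRHS]mulrC ler_wpM2l ?rnorm_bopX // invr_ge0.
Qed.

Lemma cvg_op_exp X : series (exp_term X) @ \oo --> op_exp X.
Proof.
exact: (cvg_bop_series (rnorm_exp_term X) (is_cvg_series_exp_coeff _)).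
Qed.
Arguments cvg_op_exp : clear implicits.

Lemma op_exp0 : op_exp (0 : bop H) = 1.
Proof.
apply: (cvgn_unique (cvg_op_exp 0)); apply: cvg_near_cst.
exists 1%N => // -[//|n] _.
rewrite /series /= big_nat_recl // /exp_term expr0 fact0 invr1 scale1r.
by rewrite big1 ?addr0 // => i _; rewrite expr0n scaler0.
Qed.

(** [X Z = Z Y] passes to powers, hence to partial sums, hence to limits. *)
Lemma op_exp_intertwine X Y Z : X * Z = Z * Y -> op_exp X * Z = Z * op_exp Y.
Proof.
move=> XZ.
have XZk k : X ^+ k * Z = Z * Y ^+ k.
  elim: k => [|k IHk]; first by rewrite !expr0 mul1r mulr1.
  by rewrite !exprS -mulrA IHk !mulrA XZ.
have Zcst : (fun _ : nat => Z) @ \oo --> Z by exact: cvg_cst.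
apply: (cvgn_unique (cvg_bopM (cvg_op_exp X) Zcst)).
have -> : (fun n => series (exp_term X) n * Z) = (fun n => Z * series (exp_term Y) n).
  apply/funext => n; rewrite mulr_suml mulr_sumr; apply: eq_bigr => k _.
  by rewrite /exp_term bopZl bopZr XZk.
exact: cvg_bopM Zcst (cvg_op_exp Y).
Qed.

Lemma exp_termD P Q k : GRing.comm P Q ->
  exp_term (P + Q) k = \sum_(0 <= i < k.+1) exp_term P i * exp_term Q (k - i)%N.
Proof.
move=> PQ; rewrite /exp_term addrC exprDn_comm; last exact: commr_sym.
rewrite scaler_sumr big_mkord; apply: eq_bigr => i _.
have ik : (i <= k)%N by rewrite -ltnS.
rewrite -scalerMnr scalerMnl (inv_fact_binomial _ ik).
rewrite bopZl bopZr scalerA; congr (_ *: _).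
by apply/commrX/commr_sym/commrX.
Qed.

(** The corner left over by the Cauchy product is bounded termwise by the corner
    for the real numbers [|P|] and [|Q|], and that one tends to
    [expR p * expR q - expR (p + q) = 0]. *)
Lemma op_expD P Q : GRing.comm P Q -> op_exp (P + Q) = op_exp P * op_exp Q.
Proof.
move=> PQ; set p := rnorm P; set q := rnorm Q.
pose d n := series (exp_term P) n * series (exp_term Q) n - series (exp_term (P + Q)) n.
have dE : d @ \oo --> op_exp P * op_exp Q - op_exp (P + Q).
  by apply: cvgB; [apply: cvg_bopM|]; exact: cvg_op_exp.
suff d0 : d @ \oo --> (0 : bop H).
  by apply/esym/subr0_eq/(cvgn_unique dE d0).
have expE (x : R) : series (exp_coeff x) @ \oo --> expR x.
  exact: is_cvg_series_exp_coeff.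
apply: (@cvg_rnorm_le _ _ _ _ (fun n => series (exp_coeff p) n *
    series (exp_coeff q) n - series (exp_coeff (p + q)) n)); last first.
  rewrite -(subrr (expR (p + q))) {1}expRD.
  by apply: cvgB; [apply: cvgM|]; exact: expE.
move=> n; rewrite subr0 /d /series /=.
rewrite (eq_bigr _ (fun k _ => exp_termD k PQ)).
rewrite (eq_bigr _ (fun k _ => exp_coeffD p q k)).
rewrite !cauchy_product_corner (le_trans (rnorm_sum _ _ _)) // ler_sum // => i _.
rewrite (le_trans (rnorm_sum _ _ _)) // ler_sum // => j _.
by rewrite (le_trans (rnorm_bopM _ _)) // ler_pM ?rnorm_ge0 ?rnorm_exp_term.
Qed.

Lemma op_expNK P : op_exp (- P) * op_exp P = 1.
Proof.
rewrite -op_expD; last exact/commr_sym/commrN.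
by rewrite addNr op_exp0.
Qed.

End Exponential.

(** * Two-sided multiplication by exponentials *)

(** The binomial theorem in the ring of additive endomorphisms, evaluated at a
    point. *)
Lemma iter_add_commuting (V : zmodType) (f g : {additive V -> V}) n x :
  (forall y, f (g y) = g (f y)) ->
  iter n (fun y => f y + g y) x =
  \sum_(k < n.+1) iter k f (iter (n - k) g x) *+ 'C(n, k).
Proof.
move=> fg; have itfg k y : g (iter k f y) = iter k f (g y).
  by elim: k => //= k IHk; rewrite -fg IHk.
elim: n => [|n IHn]; first by rewrite big_ord1.
rewrite iterS IHn !raddf_sum [X in X + _]big_ord_recr [X in _ + X]big_ord_recl /=.
rewrite [RHS]big_ord_recl [X in _ = _ + X]big_ord_recr /= !binn !bin0 !subnn !subn0.
rewrite [LHS]addrC -addrA; congr (_ + _).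
rewrite addrA; congr (_ + _); rewrite -big_split /=.
apply: eq_bigr => i _; rewrite !raddfMn !add0n -fg itfg.
by rewrite /bump add1n subSS -[g _]iterS subnSK // binS mulrnDr.
Qed.

Section Sandwich.
Context {R : realType} {H : completeNormedModType R[i]}.
Implicit Types (P Q B Z : bop H).

(** The hypothesis reads [P Z = Z (- Q)], so [e^P Z e^Q = Z e^(-Q) e^Q]. *)
Lemma op_exp_sandwich P Q Z : P * Z + Z * Q = 0 -> op_exp P * Z * op_exp Q = Z.
Proof.
move=> PZ; rewrite (@op_exp_intertwine _ _ P (- Q)); last first.
  by rewrite mulrN; apply/eqP; rewrite -addr_eq0 PZ.
by rewrite -mulrA op_expNK mulr1.
Qed.

(** One step of the induction trades a factor of [D] for a factor of [S - 1]:
    as [S] commutes with [D], applying [D] to [S B - B] one time less than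
    was needed to kill [B] yields [S Z - Z] with [D Z = 0]. *)
Lemma op_exp_sandwich_nilpotent P Q B n :
  iter n (fun Z => P * Z + Z * Q) B = 0 ->
  iter n (fun Z => op_exp P * Z * op_exp Q - Z) B = 0.
Proof.
set D := fun Z => P * Z + Z * Q; set S := fun Z => op_exp P * Z * op_exp Q.
have DS Z : D (S Z) = S (D Z).
  rewrite /D /S mulrDr mulrDl !mulrA -(op_exp_intertwine (erefl (P * P))).
  by rewrite -!mulrA (op_exp_intertwine (erefl (Q * Q))).
have DB Y Z : D (Y - Z) = D Y - D Z.
  by rewrite /D mulrBr mulrBl opprD addrACA.
have itD k Z : iter k D (S Z - Z) = S (iter k D Z) - iter k D Z.
  by elim: k => //= k ->; rewrite DB DS.
elim: n B => // n IHn B DnB; rewrite iterSr; apply: IHn.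
by rewrite itD /S op_exp_sandwich ?subrr.
Qed.

Lemma bop_signM n (Z : bop H) : (-1) ^+ n * Z = (-1) ^+ n *: Z.
Proof.
rewrite -signr_odd -[in RHS]signr_odd.
by case: (odd n); rewrite ?expr1 ?expr0 ?mulN1r ?scaleN1r ?mul1r ?scale1r.
Qed.

(** The two iterates of [op_exp_sandwich_nilpotent] in expanded form. *)
Lemma op_exp_binomial P Q B n :
  \sum_(k < n.+1) (P ^+ k * B * Q ^+ (n - k)) *+ 'C(n, k) = 0 ->
  \sum_(k < n.+1) (-1) ^+ (n - k) *+ 'C(n, k) * (op_exp P ^+ k * B * op_exp Q ^+ k) = 0.
Proof.
have iterl k A Z : iter k (A \*o idfun) Z = A ^+ k * Z :> bop H.
  by elim: k => /= [|k ->]; rewrite ?expr0 ?mul1r // exprS mulrA.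
have iterr k A Z : iter k (A \o* idfun) Z = Z * A ^+ k :> bop H.
  by elim: k => /= [|k ->]; rewrite ?expr0 ?mulr1 // exprSr mulrA.
move=> PQ0.
have PQ : iter n (fun Z => P * Z + Z * Q) B = 0.
  rewrite (@iter_add_commuting (bop H) (P \*o idfun) (Q \o* idfun)) => [|Z];
    last exact: mulrA.
  by rewrite -[RHS]PQ0; apply: eq_bigr => k _; rewrite iterl iterr mulrA.
rewrite -[RHS](op_exp_sandwich_nilpotent PQ).
rewrite (@iter_add_commuting (bop H) (op_exp Q \o* (op_exp P \*o idfun)) -%R) => [|Z].
  apply: eq_bigr => k _ /=.
  have -> : iter (n - k) -%R B = (-1) ^+ (n - k) * B.
    by elim: (n - k)%N => /= [|j ->]; rewrite ?expr0 ?mul1r // exprS mulN1r mulNr.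
  have itS Z : iter k (op_exp Q \o* (op_exp P \*o idfun)) Z =
      op_exp P ^+ k * Z * op_exp Q ^+ k.
    elim: (nat_of_ord k) => /= [|j ->]; first by rewrite !expr0 mul1r mulr1.
    by rewrite exprS exprSr !mulrA.
  by rewrite itS mulrnAl !bop_signM bopZr bopZl.
exact: raddfN.
Qed.

End Sandwich.

(** * Inner products and the Riesz representation theorem *)

Section InnerProduct.
Context {R : realType} {H : hilbertType R}.
Implicit Types (x y z : H) (r : R) (w : R[i]).
Local Open Scope classical_set_scope.

Lemma ReD w1 w2 : complex.Re (w1 + w2) = complex.Re w1 + complex.Re w2.
Proof. by case: w1 w2 => [? ?] [? ?]. Qed.

Lemma ReN w : complex.Re (- w) = - complex.Re w.
Proof. by case: w. Qed.

Lemma ReZ r w : complex.Re (r%:C * w) = r * complex.Re w.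
Proof. by case: w => a b; rewrite /= mul0r subr0. Qed.

Lemma Re_conj w : complex.Re (Num.conj w) = complex.Re w.
Proof. by case: w. Qed.

Lemma Re_normc_le w : `|complex.Re w| <= complex.Re `|w|.
Proof.
case: w => a b /=; rewrite -sqrtr_sqr ler_sqrt ?addr_ge0 ?sqr_ge0 //.
by rewrite lerDl sqr_ge0.
Qed.

Lemma inner_conj x y : inner x y = Num.conj (inner y x).
Proof. by rewrite (hermC (@inner R H)) expr0 mul1r. Qed.

Lemma innerDl x y z : inner (x + y) z = inner x z + inner y z.
Proof. exact: (linearDl (@inner R H) z). Qed.

Lemma innerDr x y z : inner x (y + z) = inner x y + inner x z.
Proof. exact: (linearDr (@inner R H) x). Qed.

Lemma inner_suml (I : Type) (r : seq I) (P : pred I) (F : I -> H) z :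
  inner (\sum_(i <- r | P i) F i) z = \sum_(i <- r | P i) inner (F i) z.
Proof. exact: (linear_sumlz (@inner R H)). Qed.

Lemma inner_sumr (I : Type) (r : seq I) (P : pred I) (F : I -> H) x :
  inner x (\sum_(i <- r | P i) F i) = \sum_(i <- r | P i) inner x (F i).
Proof. exact: (linear_sumr (@inner R H)). Qed.

Lemma innerBl x y z : inner (x - y) z = inner x z - inner y z.
Proof. exact: (linearBl (@inner R H) z). Qed.

Lemma innerBr x y z : inner x (y - z) = inner x y - inner x z.
Proof. exact: (linearBr (@inner R H) x). Qed.

Lemma innerZl w x z : inner (w *: x) z = w * inner x z.
Proof. exact: (linearZl_LR (@inner R H) z). Qed.

Lemma innerZr w x z : inner x (w *: z) = Num.conj w * inner x z.
Proof. exact: (linearZr_LR (@inner R H) x). Qed.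

Lemma sqr_rnormE x : (rnorm x ^+ 2)%:C = inner x x.
Proof. by rewrite inner_norm -rnormE rmorphXn. Qed.

Lemma sqr_rnormD x y :
  rnorm (x + y) ^+ 2 = rnorm x ^+ 2 + rnorm y ^+ 2 + complex.Re (inner x y) *+ 2.
Proof.
have -> : rnorm (x + y) ^+ 2 = complex.Re (inner (x + y) (x + y)).
  by rewrite -sqr_rnormE.
by rewrite dnormD -!sqr_rnormE !ReD Re_conj.
Qed.

Lemma inner_eq0 x : (forall y, inner y x = 0) -> x = 0.
Proof.
move=> /(_ x); rewrite inner_norm => /eqP.
by rewrite sqrf_eq0 normr_eq0 => /eqP.
Qed.

(** Expand [0 <= |q x - <x, y> y|^2] with [q = |y|^2] and divide by [q]. *)
Lemma cauchy_schwarz x y : complex.Re `|inner x y| <= rnorm x * rnorm y.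
Proof.
rewrite -lecR real_complexM Re_normr !rnormE.
rewrite -ler_sqr ?nnegrE ?mulr_ge0 // exprMn -!inner_norm.
have [->|y0] := eqVneq y 0; first by rewrite !linear0r normr0 expr0n.
have yy : 0 < inner y y by rewrite inner_norm exprn_gt0 // normr_gt0.
have := dnorm_ge0 (@inner R H) (inner y y *: x - inner x y *: y).
rewrite dnormB !dnormZ innerZl innerZr.
set c := inner x y; set q := inner y y in yy *.
have qC : Num.conj q = q by rewrite geC0_conj // ltW.
have nq : `|q| = q by rewrite gtr0_norm.
have -> : q * (Num.conj c * c) + Num.conj (q * (Num.conj c * c)) = 2 * (q * `|c| ^+ 2).
  rewrite rmorphM rmorphM /= qC conjCK normCK [c * _]mulrC.
  by rewrite [Num.conj c * c]mulrC -mulr2n mulr_natl.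
rewrite nq; set p := inner x x; set n := `|c| ^+ 2.
have -> : q ^+ 2 * p + n * q - 2 * (q * n) = q * (p * q - n) by ring.
by rewrite pmulr_rge0 // subr_ge0.
Qed.

End InnerProduct.

Section Riesz.
Context {R : realType} {H : hilbertType R}.
Implicit Types (x y z : H) (r t : R).
Local Open Scope classical_set_scope.

(** A quadratic minimal at [0] has no linear term: if [b] is nonzero then
    [t = - b / (a + 1)] makes it negative, the shift by [1] covering the case [a = 0]. *)
Lemma quadratic_ge0_linear0 (a b : R) :
  0 <= a -> (forall t, 0 <= t ^+ 2 * a + t * b *+ 2) -> b = 0.
Proof.
move=> a0 /(_ (- b / (a + 1))).
have a1 : 0 < a + 1 by rewrite ltr_wpDl.
have -> : (- b / (a + 1)) ^+ 2 * a + - b / (a + 1) * b *+ 2 =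
    - ((b / (a + 1)) ^+ 2 * (a + 2)).
  by field; rewrite gt_eqF.
rewrite oppr_ge0 pmulr_lle0 ?ltr_wpDl // => b0.
have : (b / (a + 1)) ^+ 2 == 0 by rewrite eq_le b0 sqr_ge0.
rewrite sqrf_eq0 mulf_eq0 invr_eq0 (gt_eqF a1) orbF.
by move/eqP.
Qed.

Variables (f : H -> R[i]) (M : R).
Hypothesis f_linear : forall (a : R[i]) x y, f (a *: x + y) = a * f x + f y.
Hypothesis f_bounded : forall x, complex.Re `|f x| <= M * rnorm x.

Let f0 : f 0 = 0.
Proof. by have := f_linear (-1) 0 0; rewrite scaler0 addr0 mulN1r addNr. Qed.

Let fD x y : f (x + y) = f x + f y.
Proof. by have := f_linear 1 x y; rewrite scale1r mul1r. Qed.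

Let fZ (a : R[i]) x : f (a *: x) = a * f x.
Proof. by have := f_linear a x 0; rewrite f0 !addr0. Qed.

(** If [f = <., z>] then [J x = |x - z|^2 - |z|^2], whose only minimiser is
    [z]. *)
Let J x : R := rnorm x ^+ 2 - complex.Re (f x) *+ 2.

Let JD x y t : J (x + t%:C *: y) = J x + t ^+ 2 * rnorm y ^+ 2 +
  t * (complex.Re (inner y x) - complex.Re (f y)) *+ 2.
Proof.
rewrite /J sqr_rnormD inner_conj Re_conj innerZl ReZ fD fZ ReD ReZ rnormZ exprMn.
have -> : complex.Re `|t%:C| ^+ 2 = t ^+ 2.
  by rewrite /= expr0n addr0 sqrtr_sqr real_normK ?num_real.
by ring.
Qed.

Let J_lb : has_lbound (range J).
Proof.
exists (- M ^+ 2) => _ [x _ <-].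
have := Re_normc_le (f x); rewrite ler_norml => /andP[_ /le_trans/(_ (f_bounded x))].
rewrite /J => fx; have := sqr_ge0 (rnorm x - M); nra.
Qed.

Let m := inf (range J).

Let J_ge x : m <= J x.
Proof. by apply: ge_inf => //; exists x. Qed.

(** The parallelogram law for [J], compared with its value at the midpoint:
    near-minimisers are close to each other. *)
Let J_parallelogram x y : rnorm (x - y) ^+ 2 <= (J x - m) *+ 2 + (J y - m) *+ 2.
Proof.
have := J_ge (x + (2^-1)%:C *: (y - x)); rewrite JD.
rewrite -(rnormN (x - y)) opprB => mJ.
have JDy : J y = J x + rnorm (y - x) ^+ 2 +
    (complex.Re (inner (y - x) x) - complex.Re (f (y - x))) *+ 2.
  by rewrite -[in LHS](subrK x y) addrC -[y - x]scale1r JD expr1n !mul1r !scale1r.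
move: mJ JDy; set u := rnorm _ ^+ 2; set v := _ - complex.Re (f _).
by move=> mJ JDy; nra.
Qed.

(** A minimising sequence of [J] is Cauchy and its limit [z] is a minimiser.
    The first variation of [J] at [z] in the direction [x] is
    twice [Re <x, z> - Re (f x)], which must vanish; the direction [i x] yields the
    imaginary parts. *)
Lemma riesz_representation : exists z, forall x, f x = inner x z.
Proof.
have /choice[u uJ] k : exists x, J x < m + k.+1%:R^-1.
  have : m < m + k.+1%:R^-1 by rewrite ltrDl invr_gt0.
  case/inf_lt => [|_ [x _ <-]]; last by exists x.
  by exists (J 0), 0.
have inv0 : (fun k : nat => k.+1%:R^-1 : R) @ \oo --> (0 : R) by exact: cvg_harmonic.
have [z uz] : exists z, u @ \oo --> z.
  apply/cvg_ex/rnorm_cauchy_cvg => e e0.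
  (* Two values within [e^2 / 4] of the infimum put their arguments within
     distance [e], by [J_parallelogram]. *)
  have e4 : 0 < e ^+ 2 / 4 by rewrite divr_gt0 ?exprn_gt0.
  move/cvgrPdist_le : inv0 => /(_ _ e4)[N _ invN]; exists N => p q Np Nq.
  rewrite -ler_sqr ?nnegrE ?rnorm_ge0 ?(ltW e0) // (le_trans (J_parallelogram _ _)) //.
  have inv_le n : (N <= n)%N -> n.+1%:R^-1 <= e ^+ 2 / 4.
    by move=> /invN; rewrite sub0r normrN ger0_norm.
  have := uJ p; have := uJ q; have := inv_le p Np; have := inv_le q Nq.
  set ip := p.+1%:R^-1; set iq := q.+1%:R^-1; set d := e ^+ 2; lra.
exists z.
(* [J] is continuous along [u], so [J z] is at most the infimum [m]. *)
have Jz x : J z <= J x.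
  apply: (le_trans _ (J_ge x)).
  have fu : complex.Re (f (u n)) @[n --> \oo] --> complex.Re (f z).
    apply/cvgrPdist_le => e e0.
    have M1 : 0 < `|M| + 1 by rewrite ltr_wpDl.
    move/cvg_rnormP/cvgrPdist_le : uz => /(_ _ (divr_gt0 e0 M1)).
    apply: filterS => n; rewrite sub0r normrN ger0_norm ?rnorm_ge0 // => un.
    rewrite distrC -ReN -ReD -mulN1r -fZ -fD scaleN1r (le_trans (Re_normc_le _)) //.
    rewrite (le_trans (f_bounded _)) //.
    rewrite (@le_trans _ _ ((`|M| + 1) * rnorm (u n - z))) //.
      by rewrite ler_wpM2r ?rnorm_ge0 // (le_trans (ler_norm _)) // lerDl.
    by rewrite mulrC -ler_pdivlMr.
  have Ju : J (u n) @[n --> \oo] --> J z.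
    apply: cvgB; last exact: cvgMn.
    by under eq_fun do rewrite expr2; rewrite expr2; apply: cvgM; exact: cvg_rnorm.
  have mu : m + n.+1%:R^-1 @[n --> \oo] --> m.
    by rewrite -[X in _ --> X]addr0; apply: cvgD => //; exact: cvg_cst.
  rewrite -(cvg_lim _ Ju) // -(cvg_lim _ mu) //; apply: ler_lim.
  - by apply/cvg_ex; eexists; exact: Ju.
  - by apply/cvg_ex; eexists; exact: mu.
  - by apply: nearW => n; rewrite ltW.
have Re_eq x : complex.Re (f x) = complex.Re (inner x z).
  apply/esym/subr0_eq/(@quadratic_ge0_linear0 (rnorm x ^+ 2)) => [|t].
    by rewrite sqr_ge0.
  by have := Jz (z + t%:C *: x); rewrite JD -addrA lerDl.
move=> x; have := Re_eq x; have := Re_eq ('i *: x); rewrite fZ innerZl.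
case: (f x) => a b; case: (inner x z) => c d /=.
by rewrite !mul0r !mul1r !sub0r => /oppr_inj -> ->.
Qed.

End Riesz.

(** * Adjoints *)

Section Adjoint.
Context {R : realType} {H : hilbertType R}.
Implicit Types (S T X Y : bop H) (a : R[i]).
Local Open Scope classical_set_scope.

Definition adjoint_pair T S := forall x y, inner (T x) y = inner x (S y).

Lemma inner_injr (x y : H) : (forall z, inner z x = inner z y) -> x = y.
Proof. by move=> xy; apply/subr0_eq/inner_eq0 => z; rewrite innerBr xy subrr. Qed.

(** Riesz gives the values of the adjoint pointwise; linearity follows from
    uniqueness, and the bound from [|S y|^2 = <T (S y), y> <= |T| |S y| |y|]. *)
Lemma adjoint_pair_exists T : exists S, adjoint_pair T S.
Proof.
have /choice[g gP] y : exists z, forall x, inner (T x) y = inner x z.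
  apply: (@riesz_representation _ _ (fun x => inner (T x) y) (rnorm T * rnorm y)).
    by move=> a u v; rewrite linearP innerDl innerZl.
  move=> x; rewrite (le_trans (cauchy_schwarz _ _)) // mulrAC.
  by rewrite ler_wpM2r ?rnorm_ge0 // rnorm_app.
have g_bounded : bounded_linear g.
  apply/asboolP; split=> [a u v|].
    apply: inner_injr => x; rewrite -gP.
    by rewrite !innerDr !innerZr !gP.
  exists (rnorm T) => y; rewrite -!rnormE -real_complexM lecR.
  have [g0|g0] := eqVneq (rnorm (g y)) 0; first by rewrite g0 mulr_ge0 ?rnorm_ge0.
  have gy0 : 0 < rnorm (g y) by rewrite lt_def g0 rnorm_ge0.
  rewrite -(ler_pM2r gy0) -expr2 mulrAC.
  have -> : rnorm (g y) ^+ 2 = complex.Re (inner (T (g y)) y).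
    by rewrite gP -sqr_rnormE.
  rewrite (le_trans (ler_norm _)) // (le_trans (Re_normc_le _)) //.
  rewrite (le_trans (cauchy_schwarz _ _)) //.
  by rewrite ler_wpM2r ?rnorm_ge0 // rnorm_app.
by exists (BOp g_bounded) => x y; exact: gP.
Qed.

Lemma adjP T : adjoint_pair T (adj T).
Proof. exact: (@xgetPex _ 0 [set S | adjoint_pair T S] (adjoint_pair_exists T)). Qed.

Lemma adjoint_pair_adj T S : adjoint_pair T S -> adj T = S.
Proof.
move=> TS; apply: bop_eq => y; apply: inner_injr => x.
by rewrite -adjP TS.
Qed.

Lemma adjoint_pairZ a T S :
  adjoint_pair T S -> adjoint_pair (a *: T) (Num.conj a *: S).
Proof.
move=> TS x y.
change (inner (a *: T x) y = inner x (Num.conj a *: S y)).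
by rewrite innerZl innerZr conjCK TS.
Qed.

Lemma adjoint_pairX T S n : adjoint_pair T S -> adjoint_pair (T ^+ n) (S ^+ n).
Proof.
move=> TS; elim: n => // n IHn x y.
change (inner ((T ^+ n.+1) x) y = inner x ((S ^+ n.+1) y)).
by rewrite exprS exprSr [LHS]TS [LHS]IHn.
Qed.

Lemma adjoint_pair_exp_series T S n :
  adjoint_pair T S -> adjoint_pair (series (exp_term T) n) (series (exp_term S) n).
Proof.
move=> TS x y; rewrite /series /= !bop_sumE.
rewrite inner_suml inner_sumr.
apply: eq_bigr => k _.
have := adjoint_pairZ (k`!%:R)^-1 (adjoint_pairX k TS).
by rewrite fmorphV rmorph_nat; exact.
Qed.

(** The partial sums are adjoint to each other; by Cauchy-Schwarz the defect
    [<e^T x, y> - <x, e^S y>] is bounded by quantities that tend to [0]. *)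
Lemma adjoint_pair_op_exp T S :
  adjoint_pair T S -> adjoint_pair (op_exp T) (op_exp S).
Proof.
move=> TS x y; apply/subr0_eq/normr0_eq0; rewrite -Re_normr.
set c := complex.Re _; suff c0 : c <= 0.
  by congr (_%:C); apply/eqP; rewrite eq_le c0 -lecR Re_normr normr_ge0.
pose dT n := series (exp_term T) n - op_exp T.
pose dS n := series (exp_term S) n - op_exp S.
(* Cauchy-Schwarz bounds the two halves of the defect separately. *)
pose d n := rnorm x * rnorm (dS n y) + rnorm (dT n x) * rnorm y.
have d0 : d @ \oo --> (0 : R).
  have cvg_app0 X (z : H) :
      rnorm ((series (exp_term X) n - op_exp X) z) @[n --> \oo] --> (0 : R).
    by apply/(@cvg_rnormP _ _ (fun n => series (exp_term X) n z))/cvg_app/cvg_op_exp.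
  rewrite -[0](addr0 0) -[X in X + _](mulr0 (rnorm x)) -[X in _ + X](mul0r (rnorm y)).
  by apply: cvgD; [apply: cvgMr | apply: cvgMl]; exact: cvg_app0.
rewrite -(cvg_lim _ d0) //; apply: limr_ge; first by apply/cvg_ex; exists 0.
apply: nearW => n; rewrite /c /d.
have -> : inner (op_exp T x) y - inner x (op_exp S y) =
    inner x (dS n y) - inner (dT n x) y.
  rewrite [inner (dT n x) y]innerBl [inner x (dS n y)]innerBr.
  by rewrite (adjoint_pair_exp_series n TS) opprB [RHS]addrC addrA subrK.
rewrite -lecR Re_normr real_complexD (le_trans (ler_normB _ _)) //.
by rewrite lerD // -Re_normr lecR cauchy_schwarz.
Qed.

End Adjoint.

(** * Isosymmetric operators *)

Section Isosymmetry.
Context {R : realType} {H : hilbertType R}.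
Implicit Types (A B T X : bop H) (s : R) (c : R[i]).

Lemma conj_imaginary s : Num.conj (0 +i* s) = - (0 +i* s) :> R[i].
Proof. by apply/eqP; rewrite eq_complex /= oppr0 !eqxx. Qed.

Lemma adj_op_expi s T :
  adj (op_exp ((0 +i* s) *: T)) = op_exp (- ((0 +i* s) *: adj T)).
Proof.
apply/adjoint_pair_adj/adjoint_pair_op_exp.
by rewrite -scaleNr -conj_imaginary; exact/adjoint_pairZ/adjP.
Qed.

Lemma iso_op0 A T : iso_op 0 A T = A.
Proof.
by rewrite /iso_op big_ord1 subnn bin0 !expr0 mulr1n !mul1r mulr1.
Qed.

(** The scalar [c] pulls [c^n] out of the whole binomial sum, so the hypothesis
    on [X] and [T] passes to [c X] and [c T]. *)
Lemma skew_sum_exp c T X B n :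
  \sum_(k < n.+1) (X ^+ k * B * T ^+ (n - k)) *+ 'C(n, k) = 0 ->
  left_ninverse B n (op_exp (c *: T)) (op_exp (c *: X)).
Proof.
move=> XT0; apply: op_exp_binomial.
apply: (etrans _ (scaler0 _ (c ^+ n))); rewrite -[in RHS]XT0.
rewrite scaler_sumr; apply: eq_bigr => k _.
rewrite -scalerMnr !bopZX bopZr !bopZl scalerA -exprD addnC subnKC //.
by rewrite -ltnS.
Qed.

(** Replacing [X] by [- X] in the sum without signs produces the alternating
    signs, up to the global factor [(-1)^n]. *)
Lemma alternating_sum_exp c T X B n :
  \sum_(k < n.+1) (-1) ^+ (n - k) *+ 'C(n, k) * (X ^+ k * B * T ^+ (n - k)) = 0 ->
  left_ninverse B n (op_exp (c *: T)) (op_exp (- (c *: X))).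
Proof.
move=> XT0; rewrite -scalerN; apply: skew_sum_exp.
apply: (etrans _ (scaler0 _ ((-1 : R[i]) ^+ n))); rewrite -[in RHS]XT0.
rewrite scaler_sumr; apply: eq_bigr => k _.
have kn : (k <= n)%N by rewrite -ltnS.
rewrite mulrnAl bop_signM -scaleN1r bopZX !bopZl -scalerMnr scalerA; congr (_ *: _ *+ _).
by rewrite -exprD -[LHS]signr_odd -[RHS]signr_odd oddD oddB // addbA addbb.
Qed.

End Isosymmetry.

Theorem corollary2p11 (R : realType) (H : hilbertType R)
    (H_separable : separable_space H) (A T : bop H) (A_pos : positive_op A)
    (m n : nat) (n_gt0 : (1 <= n)%N)
    (iso_pos : positive_op (iso_op m A T)) :
  [/\ isosymmetric A m n T ->
        forall s : R, nisometric (iso_op m A T) n (op_exp ((0 +i* s) *: T)),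
      nsymmetric A n T ->
        forall s : R, nisometric A n (op_exp ((0 +i* s) *: T)),
      skew_isosymmetric A m n T ->
        forall s : R,
          left_ninvertible (iso_op m A T) n (op_exp ((0 +i* s) *: T))
    & skew_nsymmetric A n T ->
        forall s : R,
          left_ninverse A n (op_exp ((0 +i* s) *: T))
                            (op_exp ((0 +i* s) *: adj T))].
Proof.
split=> [Tsym s|Tsym s|Tskew s|Tskew s].
- by rewrite /nisometric {1}/iso_op adj_op_expi; exact: alternating_sum_exp.
- rewrite /nsymmetric /Omega iso_op0 in Tsym.
  by rewrite /nisometric {1}/iso_op adj_op_expi; exact: alternating_sum_exp.
- by exists (op_exp ((0 +i* s) *: adj T)); exact: skew_sum_exp.
- by rewrite /skew_nsymmetric /Lambda iso_op0 in Tskew; exact: skew_sum_exp.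
Qed.
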